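(* Let $n$ be a natural number (positive integer), let $\mathbb{C}^*=\mathbb{C}\setminus\{0\}$ and let $f_n:\mathbb{C}^*\to\mathbb{C}$ be the function $$f_n(z)=\left(\frac{z}{\bar z}\right)^n .$$ Let $r$ be a positive integer. Then $f_n$ is proper $r$-harmonic, i.e. $\Delta^r f_n=0$ and $\Delta^{r-1}f_n\neq 0$, if and only if $r=n+1$.
   Context: $\Delta=\frac{\partial^2}{\partial x^2}+\frac{\partial^2}{\partial y^2}$ ($z=x+iy$) denotes the standard Laplace operator of the Euclidean plane $\mathbb{C}$. The iterated Laplacian is given by $\Delta^0 f=f$ and $\Delta^r f=\Delta(\Delta^{r-1}f)$. The condition $\Delta^{r-1}f_n\neq 0$ means that $\Delta^{r-1}f_n$ does not vanish identically. *)

(* Defs.v *)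
From Stdlib Require Import Reals.
From Coquelicot Require Import Coquelicot.

Open Scope C_scope.

(* Functions on an open set U of C are represented by total functions C -> C.
   Partial derivatives at a point of U are local, so values outside U are
   irrelevant to everything below. *)

Definition re_xy (f : C -> C) (x y : R) : R := Re (f (x, y)).
Definition im_xy (f : C -> C) (x y : R) : R := Im (f (x, y)).

Definition Laplacian (f : C -> C) (z : C) : C :=
  ((partial_derive 2 0 (re_xy f) (Re z) (Im z)
    + partial_derive 0 2 (re_xy f) (Re z) (Im z))%R,
   (partial_derive 2 0 (im_xy f) (Re z) (Im z)
    + partial_derive 0 2 (im_xy f) (Re z) (Im z))%R).

Fixpoint iter_Laplacian (r : nat) (f : C -> C) : C -> C :=
  match r with
  | O => f
  | S k => Laplacian (iter_Laplacian k f)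
  end.

Definition ex_second_partials (u : R -> R -> R) (x y : R) : Prop :=
  forall k : nat, (k <= 2)%nat ->
    ex_derive_n (fun s => u s y) k x /\ ex_derive_n (fun t => u x t) k y.

(* [Derive] is total, with an arbitrary value where the derivative does not
   exist; this predicate says that [Laplacian f z] is a genuine one. *)
Definition ex_Laplacian (f : C -> C) (z : C) : Prop :=
  ex_second_partials (re_xy f) (Re z) (Im z) /\
  ex_second_partials (im_xy f) (Re z) (Im z).

(* The first clause expresses that Delta^r f is defined on U. *)
Definition proper_harmonic (r : nat) (U : C -> Prop) (f : C -> C) : Prop :=
  (forall k : nat, (k < r)%nat ->
     forall z : C, U z -> ex_Laplacian (iter_Laplacian k f) z) /\
  (forall z : C, U z -> iter_Laplacian r f z = 0) /\
  ~ (forall z : C, U z -> iter_Laplacian (r - 1) f z = 0).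

Definition Cstar (z : C) : Prop := z <> 0.

Definition f_ (n : nat) (z : C) : C := (z / Cconj z) ^ n.

(* Main.v *)
Require Import Defs.
From Stdlib Require Import Reals Lra Lia.
From Coquelicot Require Import Coquelicot.

Local Open Scope C_scope.

(** With [d] and [d'] the Wirtinger derivatives in [z] and in its conjugate,
    the Laplacian is [4 d d'], so on the punctured plane it sends the monomial
    [z^a * conj z^(-b)] to [-4 a b z^(a-1) * conj z^(-b-1)]
    ([Laplacian_monomial]). Since [f_n = z^n * conj z^(-n)], the [k]-th iterated
    Laplacian of [f_n] is a constant times [z^(n-k) * conj z^(-n-k)], the
    constant being the product of the factors [-4 (n-j) (n+j)] for [j < k]
    ([iter_Laplacian_f]). The factor of index [j = n] is the only one that
    vanishes, so the constant is nonzero for [k <= n] and zero for [k > n]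
    ([lap_coeff_neq_0], [lap_coeff_eq_0]). A monomial does not vanish on the
    punctured plane, hence the first iterate that is identically zero is the
    one of order [n + 1].

    Real partial derivatives replace the Wirtinger ones as follows. Along a
    curve with constant velocity [v], the derivative of a monomial is a
    combination of two monomials, whose coefficients are multiples of [v] and
    of [conj v] ([is_Cderive_monomial]). Differentiating twice gives terms in
    [v^2], [v * conj v] and [(conj v)^2]; when the contributions of [v = 1] and
    [v = i] are added, the first and third kinds cancel and only the mixed term,
    which is [4 d d'], remains. *)

(** * Complex-valued functions of a real variable *)

Definition is_Cderive (g : R -> C) (t : R) (l : C) : Prop :=
  is_derive (fun s => Re (g s)) t (Re l) /\
  is_derive (fun s => Im (g s)) t (Im l).

Lemma is_derive_eq (u : R -> R) (t l l' : R) :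
  is_derive u t l -> l = l' -> is_derive u t l'.
Proof. intros H <-. exact H. Qed.

Lemma is_Cderive_eq (g : R -> C) (t : R) (l l' : C) :
  is_Cderive g t l -> l = l' -> is_Cderive g t l'.
Proof. intros H <-. exact H. Qed.

Lemma is_Cderive_const (c : C) (t : R) : is_Cderive (fun _ => c) t 0.
Proof. split; apply @is_derive_const. Qed.

Lemma is_Cderive_plus (g h : R -> C) (t : R) (l m : C) :
  is_Cderive g t l -> is_Cderive h t m ->
  is_Cderive (fun s => g s + h s) t (l + m).
Proof.
  intros [Hg1 Hg2] [Hh1 Hh2]; split.
  - exact (is_derive_plus _ _ _ _ _ Hg1 Hh1).
  - exact (is_derive_plus _ _ _ _ _ Hg2 Hh2).
Qed.

Lemma is_Cderive_mult (g h : R -> C) (t : R) (l m : C) :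
  is_Cderive g t l -> is_Cderive h t m ->
  is_Cderive (fun s => g s * h s) t (l * h t + g t * m).
Proof.
  intros [Hg1 Hg2] [Hh1 Hh2]; split.
  - apply (is_derive_eq _ _ _ _ (is_derive_minus _ _ _ _ _
      (is_derive_mult _ _ _ _ _ Hg1 Hh1 Rmult_comm)
      (is_derive_mult _ _ _ _ _ Hg2 Hh2 Rmult_comm))).
    unfold minus, plus, opp, mult, Re, Im; simpl. ring.
  - apply (is_derive_eq _ _ _ _ (is_derive_plus _ _ _ _ _
      (is_derive_mult _ _ _ _ _ Hg1 Hh2 Rmult_comm)
      (is_derive_mult _ _ _ _ _ Hg2 Hh1 Rmult_comm))).
    unfold plus, mult, Re, Im; simpl. ring.
Qed.

Lemma is_Cderive_conj (g : R -> C) (t : R) (l : C) :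
  is_Cderive g t l -> is_Cderive (fun s => Cconj (g s)) t (Cconj l).
Proof.
  intros [H1 H2]; split; [exact H1 | exact (is_derive_opp _ _ _ H2)].
Qed.

Lemma C_norm2_gt_0 (z : C) : z <> 0 -> (0 < Re z ^ 2 + Im z ^ 2)%R.
Proof.
  destruct z as [x y]; unfold Re, Im; simpl; intros Hz.
  destruct (Req_dec x 0) as [-> | Hx]; [ | nra].
  destruct (Req_dec y 0) as [-> | Hy]; [ | nra].
  now destruct Hz.
Qed.

Lemma is_derive_norm2 (g : R -> C) (t : R) (l : C) :
  is_Cderive g t l ->
  is_derive (fun s => (Re (g s) ^ 2 + Im (g s) ^ 2)%R) t
    (2 * Re (g t) * Re l + 2 * Im (g t) * Im l)%R.
Proof.
  intros [H1 H2].
  apply (is_derive_eq _ _ _ _ (is_derive_plus _ _ _ _ _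
    (is_derive_pow _ 2 _ _ H1) (is_derive_pow _ 2 _ _ H2))).
  unfold plus; simpl. ring.
Qed.

Lemma is_Cderive_inv (g : R -> C) (t : R) (l : C) :
  g t <> 0 -> is_Cderive g t l ->
  is_Cderive (fun s => / g s) t (- l * (/ g t * / g t)).
Proof.
  intros Hn H.
  pose proof (C_norm2_gt_0 _ Hn) as Hpos.
  pose proof (is_derive_norm2 _ _ _ H) as HN.
  destruct H as [H1 H2]; split.
  - apply (is_derive_eq _ _ _ _ (is_derive_div _ _ _ _ _ H1 HN (Rgt_not_eq _ _ Hpos))).
    unfold Re, Im in *; simpl; simpl in Hpos. field. lra.
  - apply (is_derive_eq _ _ _ _ (is_derive_div _ _ _ _ _ (is_derive_opp _ _ _ H2) HN
      (Rgt_not_eq _ _ Hpos))).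
    unfold opp, Re, Im in *; simpl; simpl in Hpos. field. lra.
Qed.

Lemma is_Cderive_pow (g : R -> C) (t : R) (l : C) (n : nat) :
  is_Cderive g t l ->
  is_Cderive (fun s => g s ^ n) t (INR n * g t ^ pred n * l).
Proof.
  intros H; induction n as [ | n IH].
  - apply (is_Cderive_eq _ _ _ _ (is_Cderive_const 1 t)). simpl. ring.
  - apply (is_Cderive_eq _ _ _ _ (is_Cderive_mult _ _ _ _ _ H IH)).
    rewrite S_INR, RtoC_plus; destruct n as [ | n]; simpl pred.
    + simpl. ring.
    + rewrite Cpow_S. ring.
Qed.

Lemma locally_neq_0 (g : R -> C) (t : R) (l : C) :
  is_Cderive g t l -> g t <> 0 -> locally t (fun s => g s <> 0).
Proof.
  intros H Hn.
  assert (HC : continuous (fun s => (Re (g s) ^ 2 + Im (g s) ^ 2)%R) t).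
  { apply @ex_derive_continuous. eexists. exact (is_derive_norm2 _ _ _ H). }
  pose proof (HC (fun u => (0 < u)%R) (open_gt 0%R _ (C_norm2_gt_0 _ Hn))) as HL.
  eapply filter_imp; [ | exact HL].
  intros s Hs E; cbv beta in Hs. rewrite E in Hs. unfold Re, Im in Hs; simpl in Hs. lra.
Qed.

(** * Monomials in [z] and the inverse of its conjugate *)

Definition monomial (c : C) (a b : nat) (z : C) : C :=
  c * z ^ a * (/ Cconj z) ^ b.

Lemma Cconj_neq_0 (z : C) : z <> 0 -> Cconj z <> 0.
Proof.
  intros Hz E. apply Hz. rewrite <- (Cconj_conj z), E.
  unfold Cconj; simpl. now rewrite Ropp_0.
Qed.

(** The Wirtinger chain rule [F' = d F * v + d' F * conj v] along a curve of
    velocity [v]. The predecessor [pred a] is harmless at [a = 0], because the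
    coefficient then vanishes. *)
Lemma is_Cderive_monomial (g : R -> C) (t : R) (v c : C) (a b : nat) :
  is_Cderive g t v -> g t <> 0 ->
  is_Cderive (fun s => monomial c a b (g s)) t
    (monomial (c * INR a * v) (pred a) b (g t)
     + monomial (- (c * INR b * Cconj v)) a (S b) (g t)).
Proof.
  intros H Hn.
  pose proof (is_Cderive_mult _ _ _ _ _
    (is_Cderive_mult _ _ _ _ _ (is_Cderive_const c t) (is_Cderive_pow _ _ _ a H))
    (is_Cderive_pow _ _ _ b
      (is_Cderive_inv _ _ _ (Cconj_neq_0 _ Hn) (is_Cderive_conj _ _ _ H)))) as D.
  apply (is_Cderive_eq _ _ _ _ D).
  unfold monomial. destruct b as [ | b]; simpl pred; simpl INR; rewrite ?Cpow_S; ring.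
Qed.

(** * Second derivatives and the Laplacian *)

(** The first derivative must exist on a neighbourhood for the second one to
    be meaningful, hence [locally]. *)
Definition is_Cderive2 (g : R -> C) (t : R) (d : C) : Prop :=
  exists g' : R -> C,
    locally t (fun s => is_Cderive g s (g' s)) /\ is_Cderive g' t d.

Lemma is_derive2_Derive_n (u u' : R -> R) (t d : R) :
  locally t (fun s => is_derive u s (u' s)) -> is_derive u' t d ->
  Derive_n u 2 t = d /\ forall k, (k <= 2)%nat -> ex_derive_n u k t.
Proof.
  intros Hu Hu'.
  assert (H2 : is_derive (Derive u) t d).
  { apply (is_derive_ext_loc u'); [ | exact Hu'].
    eapply filter_imp; [ | exact Hu].
    intros s Hs; symmetry; exact (is_derive_unique _ _ _ Hs). }
  split; [exact (is_derive_unique _ _ _ H2) | ].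
  intros [ | [ | [ | k]]] Hk; simpl.
  - exact I.
  - exists (u' t). exact (locally_singleton _ _ Hu).
  - exists d. exact H2.
  - lia.
Qed.

Lemma is_Cderive2_Re (g : R -> C) (t : R) (d : C) :
  is_Cderive2 g t d ->
  Derive_n (fun s => Re (g s)) 2 t = Re d /\
  forall k, (k <= 2)%nat -> ex_derive_n (fun s => Re (g s)) k t.
Proof.
  intros [g' [H H']].
  apply (is_derive2_Derive_n _ (fun s => Re (g' s))); [ | apply H'].
  eapply filter_imp; [ | exact H]. intros s Hs; apply Hs.
Qed.

Lemma is_Cderive2_Im (g : R -> C) (t : R) (d : C) :
  is_Cderive2 g t d ->
  Derive_n (fun s => Im (g s)) 2 t = Im d /\
  forall k, (k <= 2)%nat -> ex_derive_n (fun s => Im (g s)) k t.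
Proof.
  intros [g' [H H']].
  apply (is_derive2_Derive_n _ (fun s => Im (g' s))); [ | apply H'].
  eapply filter_imp; [ | exact H]. intros s Hs; apply Hs.
Qed.

Lemma Laplacian_of_is_Cderive2 (F : C -> C) (z d1 d2 : C) :
  is_Cderive2 (fun s => F (s, Im z)) (Re z) d1 ->
  is_Cderive2 (fun s => F (Re z, s)) (Im z) d2 ->
  ex_Laplacian F z /\ Laplacian F z = d1 + d2.
Proof.
  intros H1 H2.
  destruct (is_Cderive2_Re _ _ _ H1) as [R1 ER1].
  destruct (is_Cderive2_Im _ _ _ H1) as [I1 EI1].
  destruct (is_Cderive2_Re _ _ _ H2) as [R2 ER2].
  destruct (is_Cderive2_Im _ _ _ H2) as [I2 EI2].
  split.
  - split; intros k Hk; split.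
    + exact (ER1 k Hk).
    + exact (ER2 k Hk).
    + exact (EI1 k Hk).
    + exact (EI2 k Hk).
  - change (Laplacian F z) with
      ((Derive_n (fun s => Re (F (s, Im z))) 2 (Re z)
        + Derive_n (fun s => Re (F (Re z, s))) 2 (Im z))%R,
       (Derive_n (fun s => Im (F (s, Im z))) 2 (Re z)
        + Derive_n (fun s => Im (F (Re z, s))) 2 (Im z))%R).
    rewrite R1, R2, I1, I2. reflexivity.
Qed.

(** Only the values of [F] off the origin matter: a curve that avoids the
    origin at time [t] avoids it at nearby times. *)
Lemma is_Cderive2_monomial (F : C -> C) (g : R -> C) (t : R) (v c : C) (a b : nat) :
  (forall z : C, z <> 0 -> F z = monomial c a b z) ->
  (forall s, is_Cderive g s v) -> g t <> 0 ->
  is_Cderive2 (fun s => F (g s)) t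
    (monomial (c * INR a * v * INR (pred a) * v) (pred (pred a)) b (g t)
     + monomial (- (2 * c * INR a * INR b * (v * Cconj v))) (pred a) (S b) (g t)
     + monomial (c * INR b * Cconj v * INR (S b) * Cconj v) a (S (S b)) (g t)).
Proof.
  intros HF Hg Hn.
  exists (fun s => monomial (c * INR a * v) (pred a) b (g s)
                   + monomial (- (c * INR b * Cconj v)) a (S b) (g s)).
  split.
  - pose proof (locally_neq_0 _ _ _ (Hg t) Hn) as HL.
    eapply filter_imp; [ | exact (locally_locally _ _ HL)].
    intros s Hs.
    destruct (is_Cderive_monomial g s v c a b (Hg s) (locally_singleton _ _ Hs))
      as [D1 D2].
    split.
    + apply (is_derive_ext_loc (fun s => Re (monomial c a b (g s)))); [ | exact D1].
      eapply filter_imp; [ | exact Hs]. intros u Hu; now rewrite HF.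
    + apply (is_derive_ext_loc (fun s => Im (monomial c a b (g s)))); [ | exact D2].
      eapply filter_imp; [ | exact Hs]. intros u Hu; now rewrite HF.
  - eapply is_Cderive_eq.
    + apply is_Cderive_plus; apply is_Cderive_monomial; auto.
    + unfold monomial. ring.
Qed.

(** In the sum over the velocities [1] and [i], the terms carrying [v^2] and
    [(conj v)^2] cancel since [i^2 = (-i)^2 = -1], while [v * conj v = 1] for
    both. *)
Lemma Laplacian_monomial (F : C -> C) (c : C) (a b : nat) :
  (forall z : C, z <> 0 -> F z = monomial c a b z) ->
  forall z : C, z <> 0 ->
    ex_Laplacian F z /\
    Laplacian F z = monomial (- (4 * INR a * INR b) * c) (pred a) (S b) z.
Proof.
  intros HF z Hz.
  assert (Hh : forall s, is_Cderive (fun s => (s, Im z)) s 1).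
  { intros s; split;
    [ exact (@is_derive_id R_AbsRing s)
    | exact (@is_derive_const R_AbsRing R_NormedModule (Im z) s) ]. }
  assert (Hv : forall s, is_Cderive (fun s => (Re z, s)) s Ci).
  { intros s; split;
    [ exact (@is_derive_const R_AbsRing R_NormedModule (Re z) s)
    | exact (@is_derive_id R_AbsRing s) ]. }
  assert (Ez : (Re z, Im z) = z) by (destruct z; reflexivity).
  assert (Hz' : (Re z, Im z) <> RtoC 0) by (rewrite Ez; exact Hz).
  destruct (Laplacian_of_is_Cderive2 F z _ _
    (is_Cderive2_monomial F _ (Re z) 1 c a b HF Hh Hz')
    (is_Cderive2_monomial F _ (Im z) Ci c a b HF Hv Hz')) as [HE HL].
  split; [exact HE | ].
  rewrite HL, Ez.
  assert (E1 : Cconj 1 = 1) by (unfold Cconj, RtoC; simpl; now rewrite Ropp_0).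
  assert (Ei : Cconj Ci = - Ci).
  { unfold Cconj, Ci, Copp; simpl. now rewrite Ropp_0. }
  assert (Ei2 : Ci * Ci = - (1)).
  { unfold Ci, Cmult, Copp, RtoC; simpl. f_equal; ring. }
  rewrite E1, Ei. unfold monomial. ring [Ei2].
Qed.

(** * Iterated Laplacians of [f_n] *)

Fixpoint lap_coeff (n k : nat) : C :=
  match k with
  | O => 1
  | S j => - (4 * INR (n - j) * INR (n + j)) * lap_coeff n j
  end.

Lemma lap_coeff_neq_0 (n k : nat) : (k <= n)%nat -> lap_coeff n k <> 0.
Proof.
  induction k as [ | k IH]; intros Hk.
  - exact C1_nz.
  - simpl. apply Cmult_neq_0; [ | apply IH; lia].
    rewrite <- !RtoC_mult, <- RtoC_opp. intros E. apply RtoC_inj in E.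
    pose proof (lt_0_INR (n - k) ltac:(lia)).
    pose proof (lt_0_INR (n + k) ltac:(lia)).
    nra.
Qed.

Lemma lap_coeff_eq_0 (n k : nat) : (n < k)%nat -> lap_coeff n k = 0.
Proof.
  induction k as [ | k IH]; intros Hk; [lia | simpl].
  destruct (Nat.eq_dec k n) as [-> | Hkn].
  - rewrite Nat.sub_diag. simpl INR. ring.
  - rewrite IH by lia. ring.
Qed.

(** For [k > n] the truncated difference [n - k] no longer gives the expected
    exponent, but the coefficient is then zero. *)
Lemma iter_Laplacian_f (n k : nat) (z : C) :
  z <> 0 ->
  iter_Laplacian k (f_ n) z = monomial (lap_coeff n k) (n - k) (n + k) z.
Proof.
  revert z; induction k as [ | k IH]; intros z Hz.
  - simpl. unfold f_, monomial, Cdiv.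
    rewrite Cpow_mult_l, Nat.sub_0_r, Nat.add_0_r. ring.
  - simpl iter_Laplacian.
    rewrite (proj2 (Laplacian_monomial _ _ _ _ IH z Hz)).
    replace (pred (n - k)) with (n - S k)%nat by lia.
    now rewrite Nat.add_succ_r.
Qed.

Lemma monomial_neq_0 (c : C) (a b : nat) (z : C) :
  c <> 0 -> z <> 0 -> monomial c a b z <> 0.
Proof.
  intros Hc Hz. unfold monomial.
  rewrite Cpow_inv by (now apply Cconj_neq_0).
  assert (Hw : Cconj z ^ b <> 0) by (apply Cpow_nz, Cconj_neq_0, Hz).
  repeat apply Cmult_neq_0; auto using Cpow_nz.
  intros E. apply C1_nz. rewrite <- (Cinv_r _ Hw), E. ring.
Qed.

Lemma iter_Laplacian_f_eq_0_iff (n k : nat) :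
  (forall z, Cstar z -> iter_Laplacian k (f_ n) z = 0) <-> (n < k)%nat.
Proof.
  split.
  - intros H. destruct (Nat.lt_ge_cases n k) as [Hlt | Hge]; [exact Hlt | exfalso].
    specialize (H 1 C1_nz). rewrite iter_Laplacian_f in H by exact C1_nz.
    exact (monomial_neq_0 _ _ _ _ (lap_coeff_neq_0 n k Hge) C1_nz H).
  - intros Hk z Hz. rewrite iter_Laplacian_f, lap_coeff_eq_0 by assumption.
    unfold monomial. ring.
Qed.

Theorem proposition1p1 (n r : nat) (hn : (0 < n)%nat) (hr : (0 < r)%nat) :
  proper_harmonic r Cstar (f_ n) <-> r = (n + 1)%nat.
Proof.
  unfold proper_harmonic. rewrite !iter_Laplacian_f_eq_0_iff.
  split.
  - intros [_ [H1 H2]]. lia.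
  - intros ->. split; [ | lia].
    intros k _ z Hz.
    exact (proj1 (Laplacian_monomial _ _ _ _ (iter_Laplacian_f n k) z Hz)).
Qed.
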